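(* Let $S_1,\dots,S_n$ be subsets of $[n]$ with associated $n\times n$ matrix $\Sigma=[\sigma_{ij}]$ ($\sigma_{ij}=-1$ if $j\in S_i$, $+1$ otherwise), and let $D_1,\dots,D_n$ be subspaces of $\bigotimes_{j=1}^n\mathbb C^2$ with $\dim D_i^\perp=1$ for all $i$. If $\mathrm{per}(\Sigma)\neq 0$, then there is a nonzero product vector $\ket\psi=\ket{\psi_1}\otimes\cdots\otimes\ket{\psi_n}$ with $\ket\psi^{\Gamma(S_i)}\in D_i$ for all $i=1,\dots,n$.
   Context: $\mathrm{per}(\Sigma)=\sum_{\lambda\in\mathrm{Sym}(n)}\sigma_{1,\lambda(1)}\cdots\sigma_{n,\lambda(n)}$ is the permanent. For $S\subseteq[n]$, $\ket\psi^{\Gamma(S)}$ is obtained from $\ket\psi=\ket{\psi_1}\otimes\cdots\otimes\ket{\psi_n}$ by replacing $\ket{\psi_j}$ with its complex conjugate for each $j\in S$. $D^\perp$ is the orthogonal complement. *)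

(* Defs.v *)
From HB Require Import structures.
From mathcomp Require Import all_boot all_order all_algebra all_fingroup.
From mathcomp Require Import reals.
From mathcomp.real_closed Require Import complex.
Set Implicit Arguments. Unset Strict Implicit. Unset Printing Implicit Defensive.
Import Order.TTheory GRing.Theory Num.Theory.
Local Open Scope ring_scope.

(* Computational basis of (C^2)^{tensor n}: bit strings b : 'I_n -> 'I_2. *)
Definition bits (n : nat) := {ffun 'I_n -> 'I_2}.
Definition tdim (n : nat) : nat := #|{: bits n}|.

Definition per (T : comNzRingType) (n : nat) (A : 'M[T]_n) : T :=
  \sum_(s : 'S_n) \prod_(i < n) A i (s i).

Definition sigma_mx (n : nat) (S : 'I_n -> {set 'I_n}) : 'M[int]_n :=
  \matrix_(i, j) (if j \in S i then -1 else 1).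

Section Quantum.
Variable R : realType.
Local Notation C := (R[i]).

(* The product vector psi_1 (x) ... (x) psi_n, with psi_j in C^2 (row vectors),
   as a row vector of length 2^n in the basis indexed by bit strings. *)
Definition prodvec (n : nat) (psi : 'I_n -> 'rV[C]_2) : 'rV[C]_(tdim n) :=
  \row_(k < tdim n) \prod_(j < n) psi j 0 (enum_val k j).

Definition pconj (n : nat) (S : {set 'I_n}) (psi : 'I_n -> 'rV[C]_2) :
    'I_n -> 'rV[C]_2 :=
  fun j => if j \in S then map_mx Num.conj (psi j) else psi j.

(* Orthogonal complement (w.r.t. the standard Hermitian inner product
   <u,v> = sum_k conj(u_k) v_k) of the row space of D: the row vectors v with
   sum_k conj(d_k) v_k = 0 for every row d of D, i.e. v *m (conj D)^T = 0. *)
Definition orthC (m N : nat) (D : 'M[C]_(m, N)) : 'M[C]_N :=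
  kermx (map_mx Num.conj D)^T.
End Quantum.

(* Main.v *)
Require Import Defs.
From HB Require Import structures.
From mathcomp Require Import all_boot all_order all_algebra all_fingroup.
From mathcomp Require Import boolp classical_sets reals topology normedtype.
From mathcomp Require Import derive trigo.
From mathcomp Require Import ring lra.
From mathcomp.real_closed Require Import complex.
Set Implicit Arguments. Unset Strict Implicit. Unset Printing Implicit Defensive.
Import Order.TTheory GRing.Theory Num.Theory.
Import numFieldNormedType.Exports.
Local Open Scope ring_scope.

(** Let each qubit run through the lines spanned by [qubit p t], a family over a
    torus with coordinates [(p, t)] that has degree one over the projective line.
    The hyperplane [D_i] then becomes a section of the line bundle over the
    [2n]-torus whose first Chern class is [\sum_j sigma_ij x_j], with [x_j] the
    area class of the [j]-th factor. Without a common zero, the product of these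
    Chern classes would vanish, whereas it equals [per Sigma].

    The argument is carried out on the lattice [(Z/N)^2n], with lattice gauge
    fields in place of connections. Where the [i]-th section is not small, the
    phases of the ratios of its values at neighbouring points define a gauge field
    [A i] whose curvature cancels the constant background curvature [w i] of the
    bundle. If some section is bounded below at every lattice point, the cubical
    cup product of the [n] total curvatures vanishes identically. Discrete
    summation by parts shows that its sum over the lattice depends only on the
    background curvatures, and so is a nonzero multiple of [per Sigma]. Hence for
    fine lattices there are points at which all the sections are small, and a
    common zero exists by compactness. *)

(** * Cup products of lattice gauge fields *)

Lemma prod_split_ord (K : comNzRingType) (n : nat) (k : 'I_n) (F : 'I_n -> K) :
  \prod_i F i = (\prod_(i < n | (i < k)%N) F i) * F k * \prod_(i < n | (k < i)%N) F i.
Proof.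
rewrite (bigD1 k) //= (bigID (fun i : 'I_n => (i < k)%N)) /= [RHS]mulrAC [RHS]mulrC.
congr (_ * (_ * _)); apply: eq_bigl => i; rewrite -val_eqE /= ?andbT.
  by case: ltngtP.
by case: ltngtP.
Qed.

(** * Sums over permutations weighted by the sign *)

Section AlternatingSum.
Variables (K : numDomainType) (m : nat).

Definition alt_sum (F : 'S_m -> K) : K := \sum_(s : 'S_m) (-1) ^+ s * F s.

Lemma eq_alt_sum F G : F =1 G -> alt_sum F = alt_sum G.
Proof. by move=> FG; apply: eq_bigr => s _; rewrite FG. Qed.

Lemma alt_sumB F G : alt_sum (fun s => F s - G s) = alt_sum F - alt_sum G.
Proof. by rewrite /alt_sum -sumrB; apply: eq_bigr => s _; rewrite mulrBr. Qed.

Lemma alt_sumZ c F : alt_sum (fun s => c * F s) = c * alt_sum F.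
Proof. by rewrite /alt_sum mulr_sumr; apply: eq_bigr => s _; rewrite mulrCA. Qed.

Lemma alt_sum_exchange (I : finType) (F : I -> 'S_m -> K) :
  \sum_i alt_sum (F i) = alt_sum (fun s => \sum_i F i s).
Proof.
by rewrite /alt_sum exchange_big; apply: eq_bigr => s _; rewrite mulr_sumr.
Qed.

Lemma alt_sum_tperm (a b : 'I_m) F : a != b ->
  alt_sum (fun s => F (tperm a b * s)%g) = - alt_sum F.
Proof.
move=> ab; rewrite /alt_sum [in RHS](reindex_inj (mulgI (tperm a b))) -sumrN.
apply: eq_bigr => s _.
by rewrite odd_permM odd_tperm ab signr_addb expr1 mulN1r mulNr opprK.
Qed.

Lemma alt_sum_sym (a b : 'I_m) F : a != b ->
  (forall s, F (tperm a b * s)%g = F s) -> alt_sum F = 0.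
Proof.
move=> ab FE; have := alt_sum_tperm F ab.
rewrite (eq_alt_sum FE) => /eqP; rewrite -addr_eq0 -mulr2n mulrn_eq0 /=.
by move/eqP.
Qed.

(** Exchanging [s a] and [s b] flips the sign of the permutation, so the subtracted term contributes
    as much as the other one. *)
Lemma alt_sum_antisym (a b : 'I_m) (X : 'S_m -> K) (P : 'I_m -> 'I_m -> K) :
  a != b -> (forall s, X (tperm a b * s)%g = X s) ->
  alt_sum (fun s => X s * (P (s a) (s b) - P (s b) (s a))) =
  2 * alt_sum (fun s => X s * P (s a) (s b)).
Proof.
move=> ab XE; rewrite (eq_alt_sum (fun s => mulrBr _ _ _)) alt_sumB.
rewrite mulr_natl mulr2n; congr (_ + _).
rewrite -(alt_sum_tperm _ ab); apply: eq_alt_sum => s /=.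
by rewrite XE !permM tpermL tpermR.
Qed.

End AlternatingSum.

Section LatticeCup.
Variables (K : numDomainType) (G : finZmodType) (n : nat) (e : 'I_(n + n) -> G).

Local Notation dx := (@lshift n n).
Local Notation dy := (@rshift n n).
Implicit Types (s : 'S_(n + n)) (u v : G) (i j k l : 'I_n).

(** The discrete exterior derivative [dA] on the square at [v] with sides [e a] and [e b]. *)
Definition plaquette (A : 'I_(n + n) -> G -> K) v a b :=
  A a v + A b (v + e a) - A b v - A a (v + e b).

Definition pair_step s i : G := e (s (dx i)) + e (s (dy i)).

(** In the cubical cup product of [n] 2-cochains, [s] lists the directions in which a [2n]-cube is
    traversed, two per factor; factor [i] sits on the square that starts where the first [i] pairs
    of steps end. *)
Definition corner s (k : nat) : G := \sum_(i < n | (i < k)%N) pair_step s i.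

Definition corner_from (k : 'I_n) s (i : nat) : G :=
  \sum_(j < n | (k < j < i)%N) pair_step s j.

Lemma corner_split s k i : (k < i)%N ->
  corner s i = corner s k + pair_step s k + corner_from k s i.
Proof.
move=> ki; rewrite /corner (bigD1 k) //= [pair_step s k + _]addrC addrAC.
congr (_ + _); rewrite (bigID (fun j : 'I_n => (j < k)%N)) /=.
congr (_ + _); apply: eq_bigl => j; rewrite -val_eqE /=.
  case: (ltngtP j k); rewrite ?andbF ?andbT //= => jk.
  by rewrite (ltn_trans jk ki).
by case: (ltngtP j k); rewrite ?andbF ?andbT //=.
Qed.

Lemma dx_neq_dy i j : dx i != dy j.
Proof. by rewrite eq_lrshift. Qed.

Lemma sum_translate (F : G -> K) u : \sum_v F (v + u) = \sum_v F v.
Proof. by rewrite [RHS](reindex_inj (addIr u)). Qed.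

Variables (A : 'I_n -> 'I_(n + n) -> G -> K).
Variables (w : 'I_n -> 'I_(n + n) -> 'I_(n + n) -> K).

Definition curvature i u s :=
  plaquette (A i) u (s (dx i)) (s (dy i)) + w i (s (dx i)) (s (dy i)).

Section Closed.
Variables (k : 'I_n) (v : G).

Definition lead_shift (l : nat) s i := if (l <= i)%N then e (s (dx k)) else 0.

(* The curvatures of index at least [l] are translated by [e (s (dx k))]. Passing
   from [l] to [l.+1] changes the product by second differences of [A l] that are
   symmetric in two directions, which alternation kills: this is [d (d A) = 0]. *)
Definition mixed_factor (l : nat) s i :=
  if (i < k)%N then w i (s (dx i)) (s (dy i)) else
  if i == k then A k (s (dy k)) v else
  curvature i (v + e (s (dy k)) + lead_shift l s i + corner_from k s i) s.

Definition second_diff (B : G -> K) u a b :=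
  B (u + e b) - B u - (B (u + e a + e b) - B (u + e a)).

Lemma second_diffC B u a b : second_diff B u a b = second_diff B u b a.
Proof. by rewrite /second_diff (addrAC u (e a)); ring. Qed.

(** Factors with [i < l] involve neither of the exchanged directions. For [i > l] both enter the
    base point, through [lead_shift] and the step of pair [l], and that sum is symmetric. *)
Lemma factor_tperm l (z : 'I_(n + n)) s i : (k < l)%N -> i != l ->
  (z == dx l) || (z == dy l) ->
  mixed_factor l (tperm (dx k) z * s)%g i = mixed_factor l s i.
Proof.
move=> kl il zl.
have kdl : k != l by rewrite -val_eqE /= neq_ltn kl.
have zx j : j != l -> z != dx j.
  move=> jl; case/orP: zl => /eqP ->; first by rewrite eq_lshift eq_sym.
  by rewrite eq_rlshift.
have zy j : j != l -> z != dy j.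
  move=> jl; case/orP: zl => /eqP ->; first by rewrite eq_lrshift.
  by rewrite eq_rshift eq_sym.
set t := (tperm _ _ * s)%g.
have tx j : j != l -> j != k -> t (dx j) = s (dx j).
  move=> jl jk; rewrite permM tpermD ?zx //.
  by rewrite eq_lshift eq_sym.
have ty j : j != l -> t (dy j) = s (dy j).
  by move=> jl; rewrite permM tpermD ?zy // eq_lrshift.
rewrite /mixed_factor; case: ifP => [ik|ik].
  by rewrite tx ?ty // -val_eqE /= neq_ltn ik.
case: eqP => [_|/eqP ik']; first by rewrite ty.
rewrite ty // /curvature tx // ty //.
suff -> : v + e (s (dy k)) + lead_shift l t i + corner_from k t i =
          v + e (s (dy k)) + lead_shift l s i + corner_from k s i by [].
rewrite -!addrA; congr (_ + (_ + _)).
have pE j : j != l -> j != k -> pair_step t j = pair_step s j.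
  by move=> jl jk; rewrite /pair_step tx ?ty.
rewrite /lead_shift /corner_from; case: leqP => [li|li].
  have {}li : (l < i)%N by rewrite ltn_neqAle li eq_sym il.
  rewrite (bigD1 l) ?kl //= [in RHS](bigD1 l) ?kl //= !addrA.
  congr (_ + _); last first.
    apply: eq_bigr => j /andP[/andP[kj _] jl]; apply: pE => //.
    by rewrite -val_eqE /= neq_ltn kj orbT.
  rewrite /pair_step !permM tpermL; case/orP: zl => /eqP ->.
    rewrite tpermR tpermD ?eq_lrshift //.
    by congr (_ + _); exact: addrC.
  rewrite tpermR tpermD ?eq_rlshift ?eq_lshift //.
  by rewrite -addrA addrC [e (s (dx l)) + _]addrC.
congr (_ + _); apply: eq_bigr => j /andP[kj ji]; apply: pE => //.
  by rewrite -val_eqE /= neq_ltn (ltn_trans ji li).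
by rewrite -val_eqE /= neq_ltn kj orbT.
Qed.

(** For [l <= k] nothing changes, since the factors up to [k] carry no shift. For [l > k] only
    factor [l] changes, by two second differences, each symmetric in [s (dx k)] and one direction of
    pair [l]; the other factors are invariant under the same exchange. *)
Lemma alt_factor_step l :
  alt_sum (fun s => \prod_i mixed_factor l s i) =
  alt_sum (fun s => \prod_i mixed_factor l.+1 s i).
Proof.
have [lk|kl] := leqP l k.
  apply: eq_alt_sum => s; apply: eq_bigr => i _; rewrite /mixed_factor.
  case: ltnP => // ki; case: eqP => // /eqP ik.
  have {}ki : (k < i)%N by rewrite ltn_neqAle ki andbT eq_sym.
  by rewrite /lead_shift (leq_ltn_trans lk ki) (leq_trans lk (ltnW ki)).
apply/eqP; rewrite -subr_eq0 -alt_sumB; apply/eqP.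
have factorS s i : i != l -> mixed_factor l.+1 s i = mixed_factor l s i.
  move=> il; rewrite /mixed_factor /lead_shift.
  by rewrite (_ : (l < i)%N = (l <= i)%N) // ltn_neqAle eq_sym (il : (i : nat) != l).
pose E s := (\prod_(i < n | (i < l)%N) mixed_factor l s i) *
            (\prod_(i < n | (l < i)%N) mixed_factor l s i).
pose u s := v + e (s (dy k)) + corner_from k s l.
have step s : \prod_i mixed_factor l s i - \prod_i mixed_factor l.+1 s i =
    E s * second_diff (A l (s (dx l))) (u s) (s (dx k)) (s (dy l)) -
    E s * second_diff (A l (s (dy l))) (u s) (s (dx k)) (s (dx l)).
  have lo : \prod_(i < n | (i < l)%N) mixed_factor l.+1 s i =
            \prod_(i < n | (i < l)%N) mixed_factor l s i.
    by apply: eq_bigr => i il; rewrite factorS // -val_eqE neq_ltn il.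
  have hi : \prod_(i < n | (l < i)%N) mixed_factor l.+1 s i =
            \prod_(i < n | (l < i)%N) mixed_factor l s i.
    by apply: eq_bigr => i il; rewrite factorS // -val_eqE neq_ltn il orbT.
  rewrite !(prod_split_ord l) lo hi.
  have -> : mixed_factor l s l =
      curvature l (u s + e (s (dx k))) s.
    rewrite /mixed_factor ltnNge (ltnW kl) /= -val_eqE gtn_eqF // /lead_shift leqnn.
    by rewrite /u addrAC.
  have -> : mixed_factor l.+1 s l = curvature l (u s) s.
    rewrite /mixed_factor ltnNge (ltnW kl) /= -val_eqE gtn_eqF //.
    by rewrite /lead_shift ltnn addr0.
  rewrite /E /curvature /plaquette /second_diff; ring.
have lk : dx k != dx l by rewrite eq_lshift -val_eqE ltn_eqF.
rewrite (eq_alt_sum step) alt_sumB.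
have E_tperm z s : (z == dx l) || (z == dy l) -> E (tperm (dx k) z * s)%g = E s.
  move=> zl; rewrite /E; congr (_ * _); apply: eq_bigr => i il.
    by apply: factor_tperm => //; rewrite -val_eqE neq_ltn il.
  by apply: factor_tperm => //; rewrite -val_eqE neq_ltn il orbT.
have u_tperm z s : (z == dx l) || (z == dy l) -> u (tperm (dx k) z * s)%g = u s.
  move=> zl.
  have zj x : x != dx l -> x != dy l -> x != dx k -> tperm (dx k) z x = x.
    move=> xl xl' xk; apply: tpermD; first by rewrite eq_sym.
    by case/orP: zl => /eqP ->; rewrite eq_sym.
  rewrite /u permM zj ?eq_rlshift ?eq_rshift //.
  congr (_ + _); apply: eq_bigr => j /andP[kj jl]; rewrite /pair_step !permM.
  rewrite !zj ?eq_rlshift ?eq_lrshift ?eq_rshift ?eq_lshift //.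
  - by rewrite -val_eqE ltn_eqF.
  - by rewrite -val_eqE ltn_eqF.
  - by rewrite -val_eqE gtn_eqF.
rewrite (alt_sum_sym (a := dx k) (b := dy l)) ?eq_lrshift //; last first.
  move=> s; rewrite E_tperm ?eqxx ?orbT // u_tperm ?eqxx ?orbT //.
  rewrite !permM tpermL tpermR tpermD ?eq_rlshift // second_diffC.
  by [].
rewrite (alt_sum_sym lk) ?subr0 // => s.
rewrite E_tperm ?eqxx ?orbT // u_tperm ?eqxx ?orbT //.
by rewrite !permM tpermL tpermR tpermD ?eq_lrshift // second_diffC.
Qed.

Lemma alt_factor_shift :
  alt_sum (fun s => \prod_i mixed_factor 0 s i) =
  alt_sum (fun s => \prod_i mixed_factor n s i).
Proof.
suff H p : (p <= n)%N -> alt_sum (fun s => \prod_i mixed_factor 0 s i) =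
    alt_sum (fun s => \prod_i mixed_factor p s i) by exact: H.
elim: p => // p IH pn; rewrite IH ?(ltnW pn) //.
exact: (alt_factor_step (Ordinal pn)).
Qed.

End Closed.

(** Interpolates between the two sides of the cup product formula: the first [k] factors have
    already lost their exact part [dA]. *)
Definition hybrid (k : nat) v s :=
  \prod_(i < n) ((if (i < k)%N then 0
            else plaquette (A i) (v + corner s i) (s (dx i)) (s (dy i)))
           + w i (s (dx i)) (s (dy i))).

Definition lower k s := \prod_(i < n | (i < k)%N) w i (s (dx i)) (s (dy i)).

Definition upper k u s :=
  \prod_(i < n | (k < i)%N) curvature i (u + corner_from k s i) s.

Lemma mixed_factor0 k v s : \prod_i mixed_factor k v 0 s i =
  lower k s * A k (s (dy k)) v * upper k (v + e (s (dy k)) + e (s (dx k))) s.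
Proof.
rewrite (prod_split_ord k) /mixed_factor ltnn eqxx; congr (_ * _ * _).
  by apply: eq_bigr => i ->.
by apply: eq_bigr => i ki; rewrite ltnNge (ltnW ki) /= -val_eqE gtn_eqF.
Qed.

Lemma mixed_factorn k v s : \prod_i mixed_factor k v n s i =
  lower k s * A k (s (dy k)) v * upper k (v + e (s (dy k))) s.
Proof.
rewrite (prod_split_ord k) /mixed_factor ltnn eqxx; congr (_ * _ * _).
  by apply: eq_bigr => i ->.
apply: eq_bigr => i ki; rewrite ltnNge (ltnW ki) /= -val_eqE gtn_eqF //.
by rewrite /lead_shift leqNgt ltn_ord addr0.
Qed.

Lemma hybrid_diff k v s : hybrid k v s - hybrid k.+1 v s =
  lower k s * upper k (v + corner s k + pair_step s k) s *
  plaquette (A k) (v + corner s k) (s (dx k)) (s (dy k)).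
Proof.
have split_at b : (k <= b <= k.+1)%N -> hybrid b v s = lower k s *
    ((if (k < b)%N then 0
      else plaquette (A k) (v + corner s k) (s (dx k)) (s (dy k)))
     + w k (s (dx k)) (s (dy k))) *
    upper k (v + corner s k + pair_step s k) s.
  case/andP=> kb bk; rewrite /hybrid (prod_split_ord k); congr (_ * _ * _).
    by apply: eq_bigr => i ik; rewrite (leq_trans ik kb) add0r.
  apply: eq_bigr => i ki; rewrite ltnNge (leq_trans bk ki) /= /curvature.
  by rewrite (corner_split s ki) !addrA.
by rewrite !split_at ?leqnn ?leqnSn // ltnn /=; ring.
Qed.

(** Summation by parts moves the difference from [A k] onto the product of the later curvatures,
    which is closed by [alt_factor_shift]. *)
Lemma hybrid_step k :
  \sum_v alt_sum (hybrid k v) = \sum_v alt_sum (hybrid k.+1 v).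
Proof.
apply/eqP; rewrite -subr_eq0 -sumrB; apply/eqP.
under eq_bigr do rewrite -alt_sumB (eq_alt_sum (hybrid_diff k _)).
(* The plaquette is the antisymmetrisation of the forward difference [P], so one of its two terms
   suffices, with a factor 2. *)
pose P v a b := A k b (v + e a) - A k b v.
pose X v s := lower k s * upper k (v + pair_step s k) s.
have -> : \sum_v alt_sum (fun s => lower k s *
    upper k (v + corner s k + pair_step s k) s *
    plaquette (A k) (v + corner s k) (s (dx k)) (s (dy k))) =
  \sum_v alt_sum (fun s =>
    X v s * (P v (s (dx k)) (s (dy k)) - P v (s (dy k)) (s (dx k)))).
  rewrite !alt_sum_exchange; apply: eq_alt_sum => s.
  rewrite -[RHS](sum_translate _ (corner s k)); apply: eq_bigr => v _.
  rewrite /X /P /plaquette; congr (_ * _); ring.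
have kk : dx k != dy k by exact: dx_neq_dy.
have X_tperm v s : X v (tperm (dx k) (dy k) * s)%g = X v s.
  have tx j : j != k -> (tperm (dx k) (dy k) * s)%g (dx j) = s (dx j).
    by move=> jk; rewrite permM tpermD // ?eq_rlshift // eq_lshift eq_sym.
  have ty j : j != k -> (tperm (dx k) (dy k) * s)%g (dy j) = s (dy j).
    by move=> jk; rewrite permM tpermD // ?eq_lrshift // eq_rshift eq_sym.
  rewrite /X; congr (_ * _).
    by apply: eq_bigr => j jk; rewrite tx ?ty // -val_eqE ltn_eqF.
  rewrite {1}/pair_step !permM tpermL tpermR [e _ + e _]addrC.
  apply: eq_bigr => j jk; rewrite /curvature tx ?ty -?val_eqE ?gtn_eqF //.
  congr (plaquette _ (_ + _) _ _ + _); apply: eq_bigr => i /andP[ki _].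
  by rewrite /pair_step tx ?ty -?val_eqE ?gtn_eqF.
under eq_bigr do rewrite (alt_sum_antisym _ kk (X_tperm _)).
rewrite -mulr_sumr alt_sum_exchange.
have -> : alt_sum (fun s => \sum_v X v s * P v (s (dx k)) (s (dy k))) =
  \sum_v (alt_sum (fun s => \prod_i mixed_factor k v n s i) -
          alt_sum (fun s => \prod_i mixed_factor k v 0 s i)).
  under eq_bigr do rewrite -alt_sumB.
  rewrite alt_sum_exchange; apply: eq_alt_sum => s.
  under [RHS]eq_bigr do rewrite mixed_factor0 mixed_factorn.
  (* Translating the first sum is the summation by parts. *)
  rewrite sumrB -[X in _ = X - _](sum_translate _ (e (s (dx k)))) -sumrB.
  apply: eq_bigr => v _; rewrite /X /P /pair_step.
  by rewrite (addrAC v (e (s (dy k)))) !addrA; ring.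
by under eq_bigr do rewrite alt_factor_shift subrr; rewrite big1_eq mulr0.
Qed.

(* The lattice form of the fact that the integral of a product of closed
   2-forms depends only on their cohomology classes. *)
Lemma lattice_cup_product :
  \sum_v alt_sum (fun s => \prod_i curvature i (v + corner s i) s) =
  #|G|%:R * alt_sum (fun s => \prod_i w i (s (dx i)) (s (dy i))).
Proof.
have H p : (p <= n)%N ->
    \sum_v alt_sum (hybrid 0 v) = \sum_v alt_sum (hybrid p v).
  elim: p => // p IH pn; rewrite IH ?(ltnW pn) //.
  exact: (hybrid_step (Ordinal pn)).
transitivity (\sum_v alt_sum (hybrid 0 v)).
  by apply: eq_bigr => v _; apply: eq_alt_sum => s; apply: eq_bigr.
rewrite (H n) // mulr_natl -sumr_const; apply: eq_bigr => v _.
apply: eq_alt_sum => s; apply: eq_bigr => i _.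
by rewrite ltn_ord add0r.
Qed.

End LatticeCup.

(** * Permanents as alternating sums *)

Section Permanent.
Variables (K : numDomainType) (n : nat).
Local Notation dx := (@lshift n n).
Local Notation dy := (@rshift n n).

(** One factor at a time, [alt_sum_antisym] replaces a difference by its first term and produces a
    2. *)
Lemma alt_sum_double (q : 'I_n -> 'I_(n + n) -> 'I_(n + n) -> K) :
  alt_sum (fun s => \prod_i (q i (s (dx i)) (s (dy i)) - q i (s (dy i)) (s (dx i))))
  = 2 ^+ n * alt_sum (fun s => \prod_i q i (s (dx i)) (s (dy i))).
Proof.
pose f (p : nat) (i : 'I_n) (s : 'S_(n + n)) :=
  if (i < p)%N then q i (s (dx i)) (s (dy i)) else
  q i (s (dx i)) (s (dy i)) - q i (s (dy i)) (s (dx i)).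
have H p : (p <= n)%N -> alt_sum (fun s => \prod_i f 0%N i s) =
    2 ^+ p * alt_sum (fun s => \prod_i f p i s).
  elim: p => [|p IH] pn; first by rewrite mul1r.
  rewrite (IH (ltnW pn)) exprSr -mulrA; congr (_ * _).
  pose k := Ordinal pn.
  pose X s := (\prod_(i < n | (i < k)%N) f p i s) * \prod_(i < n | (k < i)%N) f p i s.
  have fp s : \prod_i f p i s =
      X s * (q k (s (dx k)) (s (dy k)) - q k (s (dy k)) (s (dx k))).
    by rewrite (prod_split_ord k) mulrAC; congr (_ * _); rewrite /f /= ltnn.
  have fp1 s : \prod_i f p.+1 i s = X s * q k (s (dx k)) (s (dy k)).
    rewrite (prod_split_ord k) mulrAC; congr (_ * _ * _); last by rewrite /f /= ltnSn.
      by apply: eq_bigr => i /= ik; rewrite /f ltnS (ltnW ik) ik.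
    by apply: eq_bigr => i /= ik; rewrite /f ltnS leqNgt ik ltnNge (ltnW ik).
  have kk : dx k != dy k by exact: dx_neq_dy.
  rewrite (eq_alt_sum fp) (eq_alt_sum fp1); apply: alt_sum_antisym => // s.
  have t i : i != k -> f p i (tperm (dx k) (dy k) * s)%g = f p i s.
    move=> ik; rewrite /f !permM !tpermD ?eq_lrshift ?eq_rlshift //.
      by rewrite eq_rshift eq_sym.
    by rewrite eq_lshift eq_sym.
  rewrite /X; congr (_ * _); apply: eq_bigr => i /= ik;
  by rewrite t // -val_eqE /= neq_ltn ik ?orbT.
have -> := H n (leqnn n).
congr (_ * _); apply: eq_alt_sum => s; apply: eq_bigr => i _.
by rewrite /f ltn_ord.
Qed.

(** The sum is the determinant of a block diagonal matrix with two copies of the matrix [P] of [f],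
    hence the square of [\det P]. The sign of a permutation cancels, which is why a permanent and
    not a determinant appears. *)
Lemma alt_sum_select (f : {ffun 'I_n -> 'I_n}) :
  alt_sum (fun s => \prod_i ((s (dx i) == dx (f i)) && (s (dy i) == dy (f i)))%:R)
  = (injectiveb f)%:R :> K.
Proof.
pose P : 'M[K]_n := \matrix_(i, j) (f i == j)%:R.
have -> : alt_sum (fun s => \prod_i
    ((s (dx i) == dx (f i)) && (s (dy i) == dy (f i)))%:R) = \det (block_mx P 0 0 P).
  apply: eq_bigr => s _; congr (_ * _); rewrite big_split_ord /= -big_split /=.
  apply: eq_bigr => i _; rewrite -mulnb natrM; congr (_ * _).
    case: (split_ordP (s (dx i))) => j ->.
      by rewrite block_mxEul mxE eq_lshift eq_sym.
    by rewrite block_mxEur mxE eq_rlshift.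
  case: (split_ordP (s (dy i))) => j ->.
    by rewrite block_mxEdl mxE eq_lrshift.
  by rewrite block_mxEdr mxE eq_rshift eq_sym.
rewrite det_ublock.
case: (boolP (injectiveb f)) => [/injectiveP inj|/injectivePn[i [j ij fij]]].
  have -> : P = perm_mx (perm inj).
    by apply/matrixP => i j; rewrite !mxE permE.
  by rewrite det_perm -signr_addb addbb.
rewrite (determinant_alternate ij) ?mul0r // => k.
by rewrite !mxE fij.
Qed.

(** Expanding the product gives one term per function [f]; by [alt_sum_select] the bijections
    survive, all with coefficient 1. *)
Lemma alt_sum_per (sg : 'M[K]_n) :
  alt_sum (fun s => \prod_i
    \sum_j sg i j * ((s (dx i) == dx j) && (s (dy i) == dy j))%:R) = per sg.
Proof.
under eq_alt_sum do rewrite bigA_distr_bigA /=.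
rewrite -alt_sum_exchange.
transitivity (\sum_(f : {ffun 'I_n -> 'I_n} | injectiveb f) \prod_i sg i (f i)).
  rewrite [RHS]big_mkcond; apply: eq_bigr => f _.
  under eq_alt_sum do rewrite big_split /=.
  by rewrite alt_sumZ alt_sum_select mulr_natr; case: ifP.
rewrite (reindex (@pval _)) /=; last first.
  by exists (insubd (1%g : 'S_n)) => /= f Uf; first apply: val_inj; apply: insubdK.
apply: eq_big => [s|s _]; first by rewrite (valP s).
by apply: eq_bigr => i _; rewrite -pvalE.
Qed.

End Permanent.

(** * Phases of complex numbers *)

Section ComplexPhase.
Variable R : realType.
Local Notation C := (R[i]).
Local Notation Re := (@complex.Re R).
Local Notation Im := (@complex.Im R).
Local Open Scope complex_scope.
Implicit Types (x y z : C) (t a b : R).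

(** The modulus with values in [R]; the norm on [C] takes its values in [C]. *)
Definition cabs z : R := Normc.normc z.

Lemma cabsM x y : cabs (x * y) = cabs x * cabs y.
Proof. exact: Normc.normcM. Qed.

Lemma cabsV z : cabs z^-1 = (cabs z)^-1.
Proof. exact: Normc.normcV. Qed.

Lemma cabs_ge0 z : 0 <= cabs z.
Proof. by case: z => a b; exact: sqrtr_ge0. Qed.

Lemma cabs_sqr z : cabs z ^+ 2 = Re z ^+ 2 + Im z ^+ 2.
Proof. by case: z => a b; rewrite /cabs /= sqr_sqrtr ?addr_ge0 ?sqr_ge0. Qed.

Lemma cabs_triangle x y : cabs (x + y) <= cabs x + cabs y.
Proof. exact: le_normcD. Qed.

Lemma cabs_opp z : cabs (- z) = cabs z.
Proof. exact: normcN. Qed.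

Lemma cabs_conj z : cabs z^* = cabs z.
Proof. by case: z => a b; rewrite /cabs /= sqrrN. Qed.

Lemma cabs_real a : cabs a%:C = `|a|.
Proof. by rewrite /cabs /= expr0n addr0 sqrtr_sqr. Qed.

Lemma cabs_eq0 z : (cabs z == 0) = (z == 0).
Proof.
by apply/eqP/eqP => [/Normc.eq0_normc|->] //; exact: Normc.normc0.
Qed.

Lemma cabs_sum (I : Type) (r : seq I) (F : I -> C) :
  cabs (\sum_(i <- r) F i) <= \sum_(i <- r) cabs (F i).
Proof.
elim: r => [|i r IH]; first by rewrite !big_nil /cabs Normc.normc0.
by rewrite !big_cons (le_trans (cabs_triangle _ _)) // lerD2l.
Qed.

Lemma cabs_prod (I : Type) (r : seq I) (P : pred I) (F : I -> C) :
  cabs (\prod_(i <- r | P i) F i) = \prod_(i <- r | P i) cabs (F i).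
Proof.
by apply: (big_morph cabs cabsM); exact: Normc.normc1.
Qed.

Definition cis t : C := cos t +i* sin t.

Lemma cis0 : cis 0 = 1.
Proof. by rewrite /cis cos0 sin0. Qed.

Lemma cisD a b : cis (a + b) = cis a * cis b.
Proof. by rewrite /cis; simpc; rewrite cosD sinD addrC; congr (_ +i* _); ring. Qed.

Lemma cisN a : cis (- a) = (cis a)^*.
Proof. by rewrite /cis cosN sinN. Qed.

Lemma cabs_cis a : cabs (cis a) = 1.
Proof. by rewrite /cabs /= cos2Dsin2 sqrtr1. Qed.

Lemma cisVN a : (cis a)^-1 = cis (- a).
Proof.
have ca : cis a != 0 by rewrite -cabs_eq0 cabs_cis oner_eq0.
by apply: (mulfI ca); rewrite divff // -cisD subrr cis0.
Qed.

Lemma cis2pi : cis (pi *+ 2) = 1.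
Proof. by rewrite /cis cos2pi sin2pi. Qed.

(** Removes the ambiguity of angles modulo [2 * pi], turning relations between holonomies into
    relations between real phases. *)
Lemma cis_eq1 t : `|t| < pi *+ 2 -> cis t = 1 -> t = 0.
Proof.
move=> tpi [ct _]; apply/eqP; apply: contraT => t0.
have t2 : 0 < `|t| / 2 < pi.
  rewrite divr_gt0 ?normr_gt0 //=; rewrite mulr2n in tpi; lra.
have := sin_gt0_pi t2.
have := cos2sin2 (`|t| / 2); have := cos_mulr2n (`|t| / 2).
have -> : (`|t| / 2) *+ 2 = `|t| by rewrite mulr2n; lra.
rewrite cos_norm ct => h1 h2 h3.
have : 0 < sin (`|t| / 2) ^+ 2 by rewrite exprn_gt0.
rewrite -mulr_natr in h1; lra.
Qed.

Lemma sin_abs_le t : `|sin t| <= `|t|.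
Proof.
wlog t0 : t / 0 < t => [H|].
  have [t0|t0|<-] := ltgtP 0 t; last by rewrite sin0.
    exact: H.
  by rewrite -normrN -sinN -(normrN t); apply: H; rewrite oppr_gt0.
have [c _] := MVT t0 (fun u : R => fun _ => is_derive_sin u)
  (continuous_subspaceT (@continuous_sin R)).
rewrite sin0 !subr0 => ->; rewrite normrM ler_piMl //.
exact: cos_max.
Qed.

Lemma cabs_cis_sub1 t : cabs (cis t - 1) <= `|t|.
Proof.
rewrite -(@ler_pXn2r _ 2) ?nnegrE ?cabs_ge0 // cabs_sqr /= subr0.
have -> : (cos t - 1) ^+ 2 + sin t ^+ 2 = 4 * sin (t / 2) ^+ 2.
  have := cos2Dsin2 t; have := cos2sin2 (t / 2); have := cos_mulr2n (t / 2).
  have -> : (t / 2) *+ 2 = t by rewrite mulr2n; lra.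
  by rewrite -mulr_natr => h1 h2 h3; lra.
have h : sin (t / 2) ^+ 2 <= (t / 2) ^+ 2.
  by rewrite -[leLHS]real_normK ?num_real // -[leRHS]real_normK ?num_real //
     lerXn2r ?nnegrE ?sin_abs_le.
rewrite real_normK ?num_real //; lra.
Qed.

(** An argument of [z] only where the real part is positive. *)
Definition phase z : R := atan (Im z / Re z).

(** The disc lies in the sector where the imaginary part is smaller in size than the real part, so
    [atan] gives the argument. With the bound [pi / 4], four phases and a flux of at most [pi / 2]
    stay below [2 * pi]. *)
Lemma phaseP z : cabs (z - 1) <= 1 / 4 ->
  z = (cabs z)%:C * cis (phase z) /\ `|phase z| < pi / 4.
Proof.
case: z => a b; rewrite /cabs /phase /= => h.
have hh : (a - 1) ^+ 2 + b ^+ 2 <= 1 / 16.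
  move: h; rewrite -(@ler_pXn2r _ 2) ?nnegrE ?sqrtr_ge0 //.
    rewrite oppr0 addr0 sqr_sqrtr ?addr_ge0 ?sqr_ge0 // => h; lra.
  by lra.
have a0 : 1 / 2 < a by nra.
have b1 : b < a by nra.
have b2 : - a < b by nra.
have a0' : 0 < a by lra.
split; last first.
  rewrite -atan1 ltr_norml -atanN; apply/andP; split; apply: lt_atan.
    by rewrite ltr_pdivlMr // mulN1r.
  by rewrite ltr_pdivrMr // mul1r.
have c0 : cos (atan (b / a)) = a / Num.sqrt (a ^+ 2 + b ^+ 2).
  rewrite cos_atan -[1](divff (expf_neq0 2 (lt0r_neq0 a0'))) exprMn exprVn.
  rewrite -mulrDl sqrtrM ?addr_ge0 ?sqr_ge0 // -exprVn sqrtr_sqr ger0_norm.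
    by rewrite invfM invrK mulrC.
  by rewrite invr_ge0 ltW.
have s0 : 0 < Num.sqrt (a ^+ 2 + b ^+ 2).
  by rewrite sqrtr_gt0 ltr_pwDl ?sqr_ge0 // exprn_gt0.
have s1 : sin (atan (b / a)) = b / Num.sqrt (a ^+ 2 + b ^+ 2).
  have cn : cos (atan (b / a)) != 0.
    by rewrite c0 mulf_neq0 ?invr_eq0 ?lt0r_neq0.
  have := atanK (b / a); rewrite /tan => /(congr1 (fun r : R => r * cos (atan (b / a)))).
  rewrite divfK // => ->; rewrite c0; field.
  by rewrite !lt0r_neq0.
rewrite /cis c0 s1; simpc; congr (_ +i* _); by rewrite mulrC divfK ?lt0r_neq0.
Qed.

End ComplexPhase.

(** * Sections of line bundles on a lattice *)

Section LatticeLineBundle.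
Variables (R : realType) (G : finZmodType) (n : nat) (e : 'I_(n + n) -> G).
Local Notation C := (R[i]).
Local Open Scope complex_scope.
Variables (f : G -> C) (U : 'I_(n + n) -> G -> C).
Variables (w : 'I_(n + n) -> 'I_(n + n) -> R) (eta : R).
Hypothesis eta0 : 0 < eta.
Hypothesis normU : forall a v, cabs (U a v) = 1.
Hypothesis holonomyU : forall a b v,
  U a v * U b (v + e a) = U b v * U a (v + e b) * cis (w a b).
Hypothesis w_small : forall a b, `|w a b| <= pi / 2.
Hypothesis f_step : forall a v, cabs (f (v + e a) - U a v * f v) <= eta.

(** Gauge invariant, and close to 1 where [f] is large compared with [eta]. *)
Definition link_ratio a v := f (v + e a) / (U a v * f v).

Definition link_phase a v := phase (link_ratio a v).

Lemma link_neq0 a v : U a v != 0.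
Proof. by rewrite -cabs_eq0 normU oner_eq0. Qed.

Lemma link_phaseP a v : 4 * eta <= cabs (f v) ->
  link_ratio a v = (cabs (link_ratio a v))%:C * cis (link_phase a v) /\
  `|link_phase a v| < pi / 4.
Proof.
move=> fv; apply: phaseP; have e0 := eta0; have fv0 : 0 < cabs (f v) by lra.
have f0 : f v != 0 by rewrite -cabs_eq0 lt0r_neq0.
have -> : link_ratio a v - 1 = (f (v + e a) - U a v * f v) / (U a v * f v).
  by rewrite /link_ratio; field; rewrite f0 link_neq0.
rewrite cabsM cabsV cabsM normU mul1r ler_pdivrMr //.
have := f_step a v; lra.
Qed.

Lemma f_step_lower a v : cabs (f v) - eta <= cabs (f (v + e a)).
Proof.
have := cabs_triangle (U a v * f v - f (v + e a)) (f (v + e a)).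
rewrite subrK cabsM normU mul1r -[cabs (_ - _)]cabs_opp opprB => h.
have := f_step a v; lra.
Qed.

(** Around a plaquette the values of [f] cancel in the link ratios and the holonomy of [U] remains,
    so the phases and [w a b] add up to a multiple of [2 * pi]; its size forces 0. The bound
    [6 * eta] keeps all four corners at or above [4 * eta]. *)
Lemma plaquette_flat u a b : 6 * eta <= cabs (f u) ->
  plaquette e link_phase u a b + w a b = 0.
Proof.
move=> fu; have e0 := eta0.
have ha := f_step_lower a u; have hb := f_step_lower b u.
have hab := f_step_lower b (u + e a).
have nz x : eta <= cabs x -> x != 0.
  by move=> hx; rewrite -cabs_eq0 lt0r_neq0 // (lt_le_trans eta0).
have fu0 : f u != 0 by apply: nz; lra.
have fa0 : f (u + e a) != 0 by apply: nz; lra.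
have fb0 : f (u + e b) != 0 by apply: nz; lra.
have fab0 : f (u + e a + e b) != 0 by apply: nz; lra.
have [r1 t1] := @link_phaseP a u ltac:(lra).
have [r2 t2] := @link_phaseP b (u + e a) ltac:(lra).
have [r3 t3] := @link_phaseP b u ltac:(lra).
have [r4 t4] := @link_phaseP a (u + e b) ltac:(lra).
have cw : cis (w a b) != 0 by rewrite -cabs_eq0 cabs_cis oner_eq0.
have rE : link_ratio a u * link_ratio b (u + e a) * cis (w a b) =
          link_ratio b u * link_ratio a (u + e b).
  have -> : link_ratio a u * link_ratio b (u + e a) =
     f (u + e a + e b) / f u / (U a u * U b (u + e a)).
    by rewrite /link_ratio; field; rewrite fu0 fa0 !link_neq0.
  rewrite holonomyU /link_ratio (addrAC u (e b)); field.
  by rewrite fu0 fb0 cw !link_neq0.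
have nE := congr1 (@cabs R) rE.
rewrite (cabsM (_ * _) (cis _)) cabs_cis mulr1 (cabsM (link_ratio a u))
  (cabsM (link_ratio b u)) in nE.
apply: cis_eq1.
  rewrite /plaquette; move: t1 t2 t3 t4 (w_small a b).
  rewrite !ltr_norml ler_norml => /andP[? ?] /andP[? ?] /andP[? ?] /andP[? ?] /andP[? ?].
  have := pi_gt0 R; rewrite mulr2n; lra.
have n0 : (cabs (link_ratio b u) * cabs (link_ratio a (u + e b)))%:C != 0.
  rewrite -cabs_eq0 cabs_real normr_eq0 mulf_neq0 // cabs_eq0 /link_ratio.
    by rewrite mulf_neq0 ?invr_eq0 ?mulf_neq0 ?link_neq0.
  by rewrite addrAC mulf_neq0 ?invr_eq0 ?mulf_neq0 ?link_neq0.
have cE : cis (link_phase a u) * cis (link_phase b (u + e a)) * cis (w a b) =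
          cis (link_phase b u) * cis (link_phase a (u + e b)).
  apply: (mulfI n0); rewrite -[in LHS]nE !rmorphM /=.
  rewrite [in RHS]mulrACA -r3 -r4 -rE [in RHS]r1 [in RHS]r2; ring.
rewrite /plaquette.
have -> : link_phase a u + link_phase b (u + e a) - link_phase b u -
    link_phase a (u + e b) + w a b =
  link_phase a u + link_phase b (u + e a) + w a b -
  (link_phase b u + link_phase a (u + e b)) by ring.
rewrite cisD -cisVN 2!cisD cE -cisD divff //.
by rewrite -cabs_eq0 cabs_cis oner_eq0.
Qed.

Lemma f_sum_lower (s : 'S_(n + n)) (r : seq 'I_n) (P : pred 'I_n) v :
  cabs (f v) - (size r)%:R * (2 * eta) <=
  cabs (f (v + \sum_(i <- r | P i) pair_step e s i)).
Proof.
have e0 := eta0; elim: r v => [|i r IH] v; first by rewrite big_nil addr0 mul0r subr0.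
rewrite big_cons /= -natr1 mulrDl mul1r; case: (P i); last first.
  by apply: le_trans (IH v); lra.
rewrite addrA; apply: le_trans (IH _).
have := f_step_lower (s (lshift n i)) v.
have := f_step_lower (s (rshift n i)) (v + e (s (lshift n i))).
rewrite /pair_step addrA; lra.
Qed.

End LatticeLineBundle.

Section LatticeSections.
Variables (R : realType) (G : finZmodType) (n : nat) (e : 'I_(n + n) -> G).
Local Notation C := (R[i]).
Local Notation dx := (@lshift n n).
Local Notation dy := (@rshift n n).

(** The bilinear form of the [i]-th Chern class, not yet antisymmetric: its antisymmetrisation is
    the constant background curvature. *)
Definition flux (k : R) (sg : 'M[R]_n) (i : 'I_n) (a b : 'I_(n + n)) : R :=
  k * \sum_j sg i j * ((a == dx j) && (b == dy j))%:R.

(** Otherwise every [v] has an [i] with [f i v] of modulus at least [delta]. After at most [2 * n]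
    steps the modulus is still at least [6 * eta], so curvature [i] vanishes at its corner and kills
    the product at [v]. The cup product formula, however, gives a nonzero multiple of [per sg]. *)
Lemma lattice_small_point (sg : 'M[R]_n) (k eta delta : R)
    (f : 'I_n -> G -> C) (U : 'I_n -> 'I_(n + n) -> G -> C) :
  per sg != 0 -> 0 < k -> 0 < eta -> (2 * n%:R + 6) * eta <= delta ->
  (forall i a b, `|flux k sg i a b - flux k sg i b a| <= pi / 2) ->
  (forall i a v, cabs (U i a v) = 1) ->
  (forall i a b v, U i a v * U i b (v + e a) =
     U i b v * U i a (v + e b) * cis (flux k sg i a b - flux k sg i b a)) ->
  (forall i a v, cabs (f i (v + e a) - U i a v * f i v) <= eta) ->
  exists v, forall i, cabs (f i v) < delta.
Proof.
move=> per0 k0 eta0 etad wsm U1 Uw fs; apply: contrapT => H.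
(* Where [f i] is small these phases are meaningless, which is harmless: [lattice_cup_product] holds
   for every [A]. *)
pose A i := link_phase e (f i) (U i).
have := lattice_cup_product e A (fun i a b => flux k sg i a b - flux k sg i b a).
rewrite big1 => [|v _]; last first.
  have [i fi] : exists i, delta <= cabs (f i v).
    apply: contrapT => H'; apply: H; exists v => i; rewrite ltNge.
    by apply/negP => ?; apply: H'; exists i.
  rewrite /alt_sum big1 // => s _; rewrite (bigD1 i) //= /curvature.
  rewrite (@plaquette_flat _ _ _ e (f i) (U i)
    (fun a b => flux k sg i a b - flux k sg i b a) eta) //.
    by rewrite mul0r mulr0.
  have := f_sum_lower eta0 (U1 i) (fs i) s (index_enum 'I_n) (fun j => (j < i)%N) v.
  have -> : size (index_enum 'I_n) = n.
    by rewrite -sum1_size big_const_ord iter_addn mul1n addn0.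
  rewrite -/(corner e s i) => h; lra.
rewrite alt_sum_double /flux.
under eq_alt_sum do rewrite big_split /= prodr_const card_ord.
rewrite alt_sumZ alt_sum_per => /esym/eqP.
rewrite !mulf_eq0 !expf_eq0 (negbTE per0) !pnatr_eq0 (gt_eqF k0) !andbF !orbF.
by move=> /eqP H0; have := card0_eq H0 (0 : G); rewrite !inE.
Qed.

End LatticeSections.

(** * Product vectors over the torus *)

Section ProductForm.
Variables (R : realType) (n : nat).
Local Notation C := (R[i]).
Local Open Scope complex_scope.

Definition conj_if (b : bool) (z : C) : C := if b then z^* else z.

Lemma conj_ifM b : {morph conj_if b : x y / x * y}.
Proof. by case: b => x y //=; exact: rmorphM. Qed.

Lemma conj_ifB b : {morph conj_if b : x y / x - y}.
Proof. by case: b => x y //=; exact: rmorphB. Qed.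

Lemma cabs_conj_if b z : cabs (conj_if b z) = cabs z.
Proof. by case: b; rewrite //= cabs_conj. Qed.

Lemma conj_if_cis b t : conj_if b (cis t) = cis ((if b then -1 else 1) * t) :> C.
Proof. by case: b; rewrite /= ?mulN1r ?cisN ?mul1r. Qed.

Definition prod_form (S : {set 'I_n}) (c : 'cV[C]_(tdim n))
    (psi : 'I_n -> 'rV[C]_2) : C :=
  (prodvec (pconj S psi) *m c) 0 0.

Lemma pconjE (S : {set 'I_n}) (psi : 'I_n -> 'rV[C]_2) j b :
  pconj S psi j 0 b = conj_if (j \in S) (psi j 0 b).
Proof. by rewrite /pconj; case: (j \in S); rewrite //= mxE. Qed.

Lemma prod_formE (S : {set 'I_n}) c psi : prod_form S c psi =
  \sum_(k < tdim n) (\prod_(j < n) conj_if (j \in S) (psi j 0 (enum_val k j))) * c k 0.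
Proof.
rewrite /prod_form mxE; apply: eq_bigr => k _; rewrite mxE; congr (_ * _).
by apply: eq_bigr => j _; rewrite pconjE.
Qed.

(** The form is linear in factor [j], or antilinear if [j \in S], so the multiplier [z] comes out
    conjugated exactly in the second case. The other factors have modulus at most 1. *)
Lemma prod_form_step (S : {set 'I_n}) c (psi psi' : 'I_n -> 'rV[C]_2) j z (eps : R) :
  (forall l, l != j -> psi' l = psi l) ->
  (forall l b, cabs (psi l 0 b) <= 1) ->
  (forall b, cabs (psi' j 0 b - z * psi j 0 b) <= eps) ->
  cabs (prod_form S c psi' - conj_if (j \in S) z * prod_form S c psi) <=
  eps * \sum_k cabs (c k 0).
Proof.
move=> psiE psi1 psij; rewrite !prod_formE mulr_sumr -sumrB.
apply: le_trans (cabs_sum _ _) _; rewrite mulr_sumr; apply: ler_sum => k _.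
rewrite mulrA -mulrBl cabsM ler_wpM2r ?cabs_ge0 //.
rewrite [X in X - _](bigD1 j) // [X in _ - _ * X](bigD1 j) //=.
rewrite [X in _ * X - _](eq_bigr (fun l =>
  conj_if (l \in S) (psi l 0 (enum_val k l)))); last first.
  by move=> l lj; rewrite psiE.
rewrite mulrA -mulrBl -conj_ifM -conj_ifB cabsM cabs_conj_if.
apply: (@le_trans _ _
  (cabs (psi' j 0 (enum_val k j) - z * psi j 0 (enum_val k j)))) => //.
rewrite ler_piMr ?cabs_ge0 // cabs_prod.
apply: prodr_ile1 => l _; rewrite cabs_ge0 cabs_conj_if; exact: psi1.
Qed.

End ProductForm.

(** * A degree-one family of lines in the qubit space *)

Section Qubit.
Variable R : realType.
Local Notation C := (R[i]).
Local Open Scope complex_scope.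

(* On the unit square, [qubit p 1 = cis (- 2 pi p) *: qubit p 0]: as a family of
   lines this is a map of degree one from the torus to the projective line. *)
Definition qubit (p t : R) : 'rV[C]_2 :=
  \row_c if c == 0 then (1 - t)%:C + t%:C * cis (- (pi *+ 2 * p))
         else (t * (1 - t))%:C.

Lemma qubit_neq0 p t : qubit p t != 0.
Proof.
apply/eqP => /rowP q0.
have := q0 0; have := q0 1; rewrite !mxE /= => -[/eqP].
rewrite mulf_eq0 subr_eq0 => /orP[/eqP ->|/eqP <-].
  by rewrite subr0 mul0r addr0 => /eqP; rewrite oner_eq0.
rewrite subrr add0r mul1r => /eqP.
by rewrite -cabs_eq0 cabs_cis oner_eq0.
Qed.

Lemma qubit_le1 p t c : 0 <= t <= 1 -> cabs (qubit p t 0 c) <= 1.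
Proof.
case/andP=> t0 t1; rewrite mxE; case: eqP => _.
  apply: le_trans (cabs_triangle _ _) _.
  by rewrite cabsM cabs_cis !cabs_real !ger0_norm //; lra.
by rewrite cabs_real ger0_norm; nra.
Qed.

Lemma qubit_stepx p p' t z c : 0 <= t <= 1 ->
  cabs (qubit p' t 0 c - z * qubit p t 0 c) <=
  cabs (cis (- (pi *+ 2 * p')) - cis (- (pi *+ 2 * p))) + cabs (z - 1).
Proof.
move=> t01; case/andP: (t01) => t0 t1.
have -> : qubit p' t 0 c - z * qubit p t 0 c =
  (qubit p' t 0 c - qubit p t 0 c) - (z - 1) * qubit p t 0 c by ring.
apply: le_trans (cabs_triangle _ _) _; apply: lerD; last first.
  by rewrite cabs_opp cabsM ler_piMr ?cabs_ge0 // qubit_le1.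
rewrite !mxE; case: eqP => _; last by rewrite subrr (cabs_real 0) normr0 cabs_ge0.
rewrite opprD addrACA subrr add0r -mulrBr cabsM cabs_real ger0_norm //.
by rewrite ler_piMl ?cabs_ge0.
Qed.

Lemma qubit_stepy p t t' c : 0 <= t <= 1 -> 0 <= t' <= 1 ->
  cabs (qubit p t' 0 c - qubit p t 0 c) <= 2 * `|t' - t|.
Proof.
move=> /andP[t0 t1] /andP[t'0 t'1]; rewrite !mxE; case: eqP => _.
  have -> : (1 - t')%:C + t'%:C * cis (- (pi *+ 2 * p)) -
     ((1 - t)%:C + t%:C * cis (- (pi *+ 2 * p))) =
     (t' - t)%:C * (cis (- (pi *+ 2 * p)) - 1) by rewrite !rmorphB /= rmorph1; ring.
  rewrite cabsM cabs_real mulrC ler_wpM2r //.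
  apply: le_trans (cabs_triangle _ _) _; rewrite cabs_opp cabs_cis.
  by rewrite (cabs_real 1) normr1; lra.
rewrite -[_ - _](rmorphB (real_complex R)) cabs_real.
have -> : t' * (1 - t') - t * (1 - t) = (1 - t - t') * (t' - t) by ring.
rewrite normrM ler_wpM2r // ler_norml; lra.
Qed.

(** The two vectors agree at [t = 1], and the error is linear in the distance from there. *)
Lemma qubit_wrap p t c : 0 <= t <= 1 ->
  cabs (qubit p 0 0 c - cis (pi *+ 2 * p) * qubit p t 0 c) <= 2 * (1 - t).
Proof.
move=> /andP[t0 t1]; rewrite !mxE; case: eqP => _.
  have -> : (1 - 0)%:C + (0 : R)%:C * cis (- (pi *+ 2 * p)) -
     cis (pi *+ 2 * p) * ((1 - t)%:C + t%:C * cis (- (pi *+ 2 * p))) =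
     (1 - t)%:C * (1 - cis (pi *+ 2 * p)).
    rewrite -cisVN !rmorphB /= rmorph1 rmorph0; field.
    by rewrite -cabs_eq0 cabs_cis oner_eq0.
  rewrite cabsM cabs_real ger0_norm ?subr_ge0 // mulrC ler_wpM2r ?subr_ge0 //.
  apply: le_trans (cabs_triangle _ _) _; rewrite cabs_opp cabs_cis.
  by rewrite (cabs_real 1) normr1; lra.
rewrite mul0r sub0r cabs_opp cabsM cabs_cis cabs_real mul1r ger0_norm; nra.
Qed.

End Qubit.

(** * The qubit family sampled on the lattice torus *)

Section TorusLattice.
Variables (R : realType) (n M : nat).
Local Notation C := (R[i]).
Local Notation N := M.+2.
Local Notation G := 'rV['I_M.+2]_(n + n).
Local Notation dx := (@lshift n n).
Local Notation dy := (@rshift n n).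
Local Open Scope complex_scope.

Definition unit_step (a : 'I_(n + n)) : G := delta_mx 0 a.

Definition mesh : R := N%:R^-1.

(** The total flux [2 * pi] of a degree-one bundle, spread evenly over the [N ^ 2] plaquettes of a
    two-dimensional torus. *)
Definition unit_flux : R := pi *+ 2 * mesh ^+ 2.

Lemma mesh_gt0 : 0 < mesh.
Proof. by rewrite invr_gt0 ltr0n. Qed.

Lemma mesh_mulN : mesh * N%:R = 1.
Proof. by rewrite mulVf // pnatr_eq0. Qed.

Lemma mesh_le_half : mesh <= 1 / 2.
Proof.
have := mesh_gt0; have := mesh_mulN; rewrite -natr1 -natr1.
have : 0 <= M%:R :> R by []. nra.
Qed.

Lemma mesh_bound (x : 'I_N) : 0 <= mesh * x%:R <= 1.
Proof.
have h := mesh_gt0; have hN := mesh_mulN.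
have x0 : 0 <= x%:R :> R by [].
have xN : x%:R <= N%:R :> R by rewrite ler_nat ltnW.
apply/andP; split; nra.
Qed.

Lemma val_succ (x : 'I_N) : (x + 1)%R = (if x.+1 == N then 0 else x.+1)%N :> nat.
Proof.
have -> : (x + 1)%R = (x.+1 %% N)%N :> nat by rewrite /= modnDmr addn1.
case: eqP => [->|/eqP xN]; first by rewrite modnn.
by rewrite modn_small // ltn_neqAle xN ltn_ord.
Qed.

Lemma last_natr (x : 'I_N) : x.+1 = N -> x%:R = N%:R - 1 :> R.
Proof. by move=> /(congr1 (fun k => k%:R : R)) <-; rewrite -[x.+1%:R]natr1 addrK. Qed.

Lemma unit_stepE (v : G) a b :
  (v + unit_step a) 0 b = if b == a then v 0 b + 1 else v 0 b.
Proof. by rewrite !mxE eqxx /=; case: eqP; rewrite ?addr0. Qed.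

(* With these links every plaquette of a qubit has the same holonomy, and the jump
   of [linky] matches [qubit p 1 = cis (- 2 pi p) *: qubit p 0]. *)
Definition linkx (y : 'I_N) : C := cis (- (unit_flux * y%:R)).

Definition linky (x y : 'I_N) : C :=
  if y.+1 == N then cis (unit_flux * N%:R * x%:R) else 1.

Lemma link_holonomy (x y : 'I_N) :
  linkx y * linky (x + 1) y = linky x y * linkx (y + 1) * cis unit_flux.
Proof.
rewrite /linkx /linky !val_succ; case: (altP (y.+1 =P N)) => [yN|yN].
  have yE := last_natr yN.
  rewrite mulr0 oppr0 cis0 mulr1 yE.
  case: (altP (x.+1 =P N)) => [xN|xN].
    have xE := last_natr xN.
    rewrite mulr0 cis0 mulr1 xE -cisD.
    (* Where both coordinates wrap, the mismatch is the total flux [2 * pi], invisible to [cis]: the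
       integrality of the Chern class. *)
    have -> : unit_flux * N%:R * (N%:R - 1) + unit_flux =
        - (unit_flux * (N%:R - 1)) + unit_flux * N%:R ^+ 2 by ring.
    have -> : unit_flux * N%:R ^+ 2 = pi *+ 2.
      by rewrite /unit_flux -mulrA -exprMn mesh_mulN expr1n mulr1.
    by rewrite [in RHS]cisD cis2pi mulr1.
  by rewrite -!cisD -[x.+1%:R]natr1; congr cis; ring.
rewrite mulr1 mul1r -cisD -[y.+1%:R]natr1; congr cis; ring.
Qed.

Definition torus_link (a : 'I_(n + n)) (v : G) : C :=
  match fintype.split a with
  | inl j => linkx (v 0 (dy j))
  | inr j => linky (v 0 (dx j)) (v 0 (dy j))
  end.

Definition qubit_of (a : 'I_(n + n)) : 'I_n :=
  match fintype.split a with inl j => j | inr j => j end.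

Lemma torus_link_x j v : torus_link (dx j) v = linkx (v 0 (dy j)).
Proof. by rewrite /torus_link (unsplitK (inl j : 'I_n + 'I_n)). Qed.

Lemma torus_link_y j v : torus_link (dy j) v = linky (v 0 (dx j)) (v 0 (dy j)).
Proof. by rewrite /torus_link (unsplitK (inr j : 'I_n + 'I_n)). Qed.

Lemma qubit_of_x j : qubit_of (dx j) = j.
Proof. by rewrite /qubit_of (unsplitK (inl j : 'I_n + 'I_n)). Qed.

Lemma qubit_of_y j : qubit_of (dy j) = j.
Proof. by rewrite /qubit_of (unsplitK (inr j : 'I_n + 'I_n)). Qed.

Lemma cabs_torus_link a v : cabs (torus_link a v) = 1.
Proof.
rewrite /torus_link /linkx /linky; case: (fintype.split a) => j; first exact: cabs_cis.
by case: ifP => _; rewrite ?cabs_cis // (cabs_real 1) normr1.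
Qed.

Lemma flux_xy k (sg : 'M[R]_n) i j l :
  flux k sg i (dx j) (dy l) = k * sg i j * (j == l)%:R.
Proof.
rewrite /flux (bigD1 j) //= big1 ?addr0 => [|m mj].
  by rewrite eqxx eq_rshift /= [l == j]eq_sym mulrA.
by rewrite eq_lshift [j == m]eq_sym (negbTE mj) mulr0.
Qed.

Lemma flux_xx k (sg : 'M[R]_n) i j l : flux k sg i (dx j) (dx l) = 0.
Proof. by rewrite /flux big1 ?mulr0 // => m _; rewrite eq_lrshift andbF mulr0. Qed.

Lemma flux_y k (sg : 'M[R]_n) i j b : flux k sg i (dy j) b = 0.
Proof. by rewrite /flux big1 ?mulr0 // => m _; rewrite eq_rlshift mulr0. Qed.

Variable S : 'I_n -> {set 'I_n}.

Definition sign_mx : 'M[R]_n := \matrix_(i, j) (if j \in S i then -1 else 1).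

Definition torus_flux i a b :=
  flux unit_flux sign_mx i a b - flux unit_flux sign_mx i b a.

Definition section_link i a v := conj_if (qubit_of a \in S i) (torus_link a v).

(** A link depends only on the coordinates of its own qubit, so only the two directions of one qubit
    fail to commute. There [link_holonomy] gives the flux, and conjugation for [j \in S i] reverses
    it: this is where [Sigma] enters. *)
Lemma section_holonomy i a b v :
  section_link i a v * section_link i b (v + unit_step a) =
  section_link i b v * section_link i a (v + unit_step b) *
  cis (torus_flux i a b).
Proof.
wlog: a b / (a <= b)%N => [H|].
  have [ab|/ltnW ba] := leqP a b; first exact: H.
  rewrite (H b a ba) -mulrA -cisD (_ : torus_flux i b a + _ = 0) ?cis0 ?mulr1 //.
  by rewrite /torus_flux; ring.
rewrite /section_link /torus_flux.
case: (split_ordP a) => j ->; case: (split_ordP b) => l -> ab.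
- rewrite !flux_xx subrr cis0 mulr1 !qubit_of_x !torus_link_x !unit_stepE.
  by rewrite !eq_rlshift mulrC.
- rewrite flux_xy flux_y subr0 qubit_of_x qubit_of_y !torus_link_x !torus_link_y.
  rewrite !unit_stepE !eq_lshift !eq_rshift eq_rlshift [l == j]eq_sym.
  case: (altP (j =P l)) => [->|_]; last by rewrite mulr0 cis0 !mulr1 mulrC.
  have -> : unit_flux * sign_mx i l * 1 =
      (if l \in S i then -1 else 1) * unit_flux by rewrite mxE; ring.
  by rewrite -conj_if_cis -!conj_ifM link_holonomy.
(* Excluded by [a <= b]: the [y] directions come after all [x] directions. *)
- by move: ab; rewrite /= leqNgt (leq_trans (ltn_ord l)) ?leq_addr.
- rewrite !flux_y subrr cis0 mulr1 !qubit_of_y !torus_link_y !unit_stepE.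
  rewrite !eq_lrshift !eq_rshift [j == l]eq_sym.
  case: (altP (l =P j)) => [->|_]; by rewrite // mulrC.
Qed.

(** With at least two points per direction, [unit_flux] is at most [2 * pi / 4]. *)
Lemma torus_flux_small i a b : `|torus_flux i a b| <= pi / 2.
Proof.
have k0 : 0 <= unit_flux.
  by apply: mulr_ge0; [rewrite mulrn_wge0 ?pi_ge0|exact: sqr_ge0].
have k1 : unit_flux <= pi / 2.
  have := pi_gt0 R; have := mesh_gt0; have := mesh_le_half.
  rewrite /unit_flux (mulr2n pi) => h1 h2 h3.
  have m2 : mesh * mesh <= (1 / 2) * (1 / 2) by apply: ler_pM => //; exact: ltW.
  rewrite expr2; set q := mesh * mesh in m2 *.
  have : pi * q <= pi * ((1 / 2) * (1 / 2)) by rewrite ler_pM2l.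
  lra.
have small j l : `|unit_flux * sign_mx i j * (j == l)%:R| <= pi / 2.
  rewrite mxE (normrM (unit_flux * _)) (normrM unit_flux) (ger0_norm k0).
  case: (j \in S i); rewrite ?normrN normr1 mulr1; case: (j == l);
  by rewrite ?normr0 ?mulr0 ?normr1 ?mulr1 // (le_trans k0).
rewrite /torus_flux.
case: (split_ordP a) => j ->; case: (split_ordP b) => l ->;
  rewrite ?flux_xx ?flux_xy ?flux_y ?subr0 ?sub0r ?normrN ?small // normr0;
  exact: le_trans k0 k1.
Qed.

Definition torus_point (v : G) : 'rV[R]_(n + n) := \row_a (mesh * (v 0 a)%:R).

Definition torus_qubits (p : 'rV[R]_(n + n)) (j : 'I_n) : 'rV[C]_2 :=
  qubit (p 0 (dx j)) (p 0 (dy j)).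

(** In an [x] direction the change of the qubit and the deviation of the link from 1 are each at
    most [2 * pi * mesh <= 8 * mesh]; in a [y] direction the error is at most [2 * mesh]. *)
Lemma torus_link_step a v c :
  cabs (torus_qubits (torus_point (v + unit_step a)) (qubit_of a) 0 c -
        torus_link a v * torus_qubits (torus_point v) (qubit_of a) 0 c)
  <= 16 * mesh.
Proof.
have h0 := mesh_gt0; have hN := mesh_mulN.
have pi0 := pi_gt0 R; have pi4 : pi < 4 :> R by have := pihalf_lt2 R; lra.
rewrite /torus_qubits.
case: (split_ordP a) => j ->.
  rewrite qubit_of_x torus_link_x ![torus_point _ _ _]mxE !unit_stepE eqxx eq_rlshift.
  set x := v 0 (dx j); set y := v 0 (dy j).
  apply: le_trans (qubit_stepx _ _ _ _ (mesh_bound y)) _.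
  (* By periodicity of [cis] this includes the wraparound in [x]. *)
  have -> : cis (- (pi *+ 2 * (mesh * (x + 1)%R%:R))) =
            cis (- (pi *+ 2 * (mesh * x%:R))) * cis (- (pi *+ 2 * mesh)) :> C.
    rewrite val_succ -cisD; case: eqP => [xN|_]; last first.
      by rewrite -natr1; congr cis; ring.
    have xE := last_natr xN.
    rewrite xE mulr0 mulr0 oppr0 cis0.
    have -> : - (pi *+ 2 * (mesh * (N%:R - 1))) + - (pi *+ 2 * mesh) =
       - (pi *+ 2) * (mesh * N%:R) :> R by ring.
    by rewrite hN mulr1 cisN cis2pi conjc1.
  set z := cis (- (pi *+ 2 * (mesh * x%:R))).
  have -> : z * cis (- (pi *+ 2 * mesh)) - z = z * (cis (- (pi *+ 2 * mesh)) - 1).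
    by ring.
  rewrite cabsM cabs_cis mul1r.
  have h1 := cabs_cis_sub1 (- (pi *+ 2 * mesh)).
  have h2 := cabs_cis_sub1 (- (unit_flux * y%:R)).
  have pm0 : 0 <= pi * mesh by rewrite mulr_ge0 // ltW.
  have pm4 : pi * mesh <= 4 * mesh by rewrite ler_pM2r // ltW.
  have e1 : `|- (pi *+ 2 * mesh)| <= 8 * mesh.
    rewrite normrN ger0_norm (mulr2n pi); lra.
  have e2 : `|- (unit_flux * y%:R)| <= 8 * mesh.
    have /andP[y0 y1] := mesh_bound y.
    have -> : unit_flux * y%:R = 2 * (pi * mesh * (mesh * y%:R)).
      by rewrite /unit_flux (mulr2n pi); ring.
    have q0 : 0 <= pi * mesh * (mesh * y%:R) by exact: mulr_ge0.
    have q1 : pi * mesh * (mesh * y%:R) <= pi * mesh by exact: ler_piMr.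
    rewrite normrN ger0_norm; lra.
  rewrite /linkx; lra.
rewrite qubit_of_y torus_link_y ![torus_point _ _ _]mxE !unit_stepE eqxx eq_lrshift.
set x := v 0 (dx j); set y := v 0 (dy j).
rewrite /linky val_succ; case: (altP (y.+1 =P N)) => [yN|yN].
  have yE : mesh * y%:R = 1 - mesh.
    by rewrite (last_natr yN) mulrBr hN mulr1.
  (* At the last [y] the link is exactly the phase of [qubit_wrap]. *)
  have -> : unit_flux * N%:R * x%:R = pi *+ 2 * (mesh * x%:R).
    have -> : unit_flux * N%:R * x%:R = pi *+ 2 * (mesh * x%:R) * (mesh * N%:R).
      by rewrite /unit_flux; ring.
    by rewrite hN mulr1.
  rewrite mulr0; apply: le_trans (qubit_wrap _ _ (mesh_bound y)) _.
  rewrite yE; lra.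
rewrite mul1r; apply: le_trans (qubit_stepy _ _ _ _) _.
- exact: mesh_bound.
- have yN' : (y.+1 < N)%N by rewrite ltn_neqAle yN ltn_ord.
  exact: (mesh_bound (Ordinal yN')).
- rewrite -[y.+1%:R]natr1 mulrDr mulr1 addrAC subrr add0r ger0_norm; lra.
Qed.

Variable c : 'I_n -> 'cV[C]_(tdim n).

Definition torus_section i p := prod_form (S i) (c i) (torus_qubits p).

(** Only the qubit of [a] moves. The sum over all indices makes the bound independent of [i], and
    the summand 1 keeps it positive even if [c] vanishes. *)
Lemma torus_section_step i a v :
  cabs (torus_section i (torus_point (v + unit_step a)) -
        section_link i a v * torus_section i (torus_point v)) <=
  16 * mesh * (1 + \sum_i \sum_k cabs (c i k 0)).
Proof.
apply: (@le_trans _ _ (16 * mesh * \sum_k cabs (c i k 0))); last first.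
  rewrite ler_wpM2l ?mulr_ge0 ?ltW ?mesh_gt0 // (bigD1 i) //=.
  have : 0 <= \sum_(j | j != i) \sum_k cabs (c j k 0).
    by do 2!apply: sumr_ge0 => ? _; exact: cabs_ge0.
  lra.
apply: prod_form_step => [l la|l b|b]; last exact: torus_link_step.
- rewrite /torus_qubits ![torus_point _ _ _]mxE; have [da db] : dx l != a /\ dy l != a.
    by split; apply: contraNneq la => <-; rewrite ?qubit_of_x ?qubit_of_y.
  by rewrite !unit_stepE (negbTE da) (negbTE db).
- by rewrite qubit_le1 // mxE mesh_bound.
Qed.

End TorusLattice.

(** * Common zeros *)

Section CommonZero.
Variables (R : realType) (n : nat) (S : 'I_n -> {set 'I_n}).
Variable c : 'I_n -> 'cV[R[i]]_(tdim n).
Hypothesis per0 : per (sigma_mx S) != 0.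
Local Open Scope complex_scope.

Lemma per_sign_mx : per (sign_mx R S) != 0.
Proof.
have -> : per (sign_mx R S) = (per (sigma_mx S))%:~R.
  rewrite /per rmorph_sum; apply: eq_bigr => s _; rewrite rmorph_prod.
  by apply: eq_bigr => i _; rewrite !mxE; case: ifP.
by rewrite intr_eq0.
Qed.

Lemma torus_section_small (delta : R) : 0 < delta ->
  exists p : 'rV[R]_(n + n), (forall a, 0 <= p 0 a <= 1) /\
    forall i, cabs (torus_section S c i p) < delta.
Proof.
move=> d0; pose B := 1 + \sum_i \sum_k cabs (c i k 0).
have B0 : 0 < B.
  by rewrite ltr_pwDl // sumr_ge0 // => i _; rewrite sumr_ge0 // => k _; exact: cabs_ge0.
(* For the step bound [16 * mesh * B], the requirement of [lattice_small_point] reads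
   [X <= M.+2]. *)
pose X := (2 * n%:R + 6) * (16 * B) / delta.
have X0 : 0 <= X.
  have n0 : 0 <= n%:R :> R by [].
  by rewrite divr_ge0 ?mulr_ge0 //; lra.
pose M := Num.bound X.
have XM : X < M.+2%:R.
  by rewrite (lt_le_trans (archi_boundP X0)) // ler_nat -addn2 leq_addr.
have k0 : 0 < unit_flux R M.
  by apply: mulr_gt0; [rewrite mulrn_wgt0 ?pi_gt0|rewrite exprn_gt0 ?mesh_gt0].
have eta0 : 0 < 16 * mesh R M * B by rewrite !mulr_gt0 ?mesh_gt0.
have etad : (2 * n%:R + 6) * (16 * mesh R M * B) <= delta.
  have -> : (2 * n%:R + 6) * (16 * mesh R M * B) = X * delta * mesh R M.
    by rewrite /X; field; rewrite lt0r_neq0.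
  by rewrite ler_pdivrMr // mulrC ler_pM2l // ltW.
have [v vP] := @lattice_small_point R _ n (@unit_step n M) (sign_mx R S)
   (unit_flux R M) _ delta
   (fun i v => torus_section S c i (torus_point R v)) (section_link R S)
   per_sign_mx k0 eta0 etad (@torus_flux_small R n M S)
   (fun i a v => etrans (cabs_conj_if _ _) (cabs_torus_link R a v))
   (@section_holonomy R n M S) (fun i a v => torus_section_step S c i a v).
exists (torus_point R v); split=> // a.
by rewrite mxE mesh_bound.
Qed.

(** Continuity by components, so that the real topology suffices. *)
Definition ccontinuous (T : topologicalType) (g : T -> R[i]) :=
  continuous (fun x => complex.Re (g x) : R) /\
  continuous (fun x => complex.Im (g x) : R).

Section ComplexContinuity.
Variable T : topologicalType.
Implicit Types g h : T -> R[i].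

Lemma ccontinuous_cst z : ccontinuous (fun _ : T => z).
Proof. by split=> x; exact: cvg_cst. Qed.

Lemma ccontinuous_real (g : T -> R) : continuous g -> ccontinuous (fun x => (g x)%:C).
Proof. by move=> gc; split=> // x; exact: cvg_cst. Qed.

Lemma ccontinuousD g h :
  ccontinuous g -> ccontinuous h -> ccontinuous (fun x => g x + h x).
Proof.
move=> [g1 g2] [h1 h2]; split=> x.
  rewrite (_ : (fun x => _) = (fun x => complex.Re (g x) + complex.Re (h x))).
    by apply: cvgD; [exact: g1|exact: h1].
  by apply/funext => y; case: (g y) => ? ?; case: (h y).
rewrite (_ : (fun x => _) = (fun x => complex.Im (g x) + complex.Im (h x))).
  by apply: cvgD; [exact: g2|exact: h2].
by apply/funext => y; case: (g y) => ? ?; case: (h y).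
Qed.

Lemma ccontinuousM g h :
  ccontinuous g -> ccontinuous h -> ccontinuous (fun x => g x * h x).
Proof.
move=> [g1 g2] [h1 h2]; split=> x.
  rewrite (_ : (fun x => _) = (fun x => complex.Re (g x) * complex.Re (h x) -
    complex.Im (g x) * complex.Im (h x))).
    apply: cvgB; apply: cvgM; by [exact: g1|exact: h1|exact: g2|exact: h2].
  by apply/funext => y; case: (g y) => ? ?; case: (h y).
rewrite (_ : (fun x => _) = (fun x => complex.Re (g x) * complex.Im (h x) +
    complex.Im (g x) * complex.Re (h x))).
  apply: cvgD; apply: cvgM; by [exact: g1|exact: h1|exact: g2|exact: h2].
by apply/funext => y; case: (g y) => ? ?; case: (h y).
Qed.

Lemma ccontinuous_conj_if b g : ccontinuous g -> ccontinuous (fun x => conj_if b (g x)).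
Proof.
move=> [g1 g2]; case: b => //; split=> x.
  rewrite (_ : (fun x => _) = (fun x => complex.Re (g x))); first exact: g1.
  by apply/funext => y /=; case: (g y).
rewrite (_ : (fun x => _) = (fun x => - complex.Im (g x))).
  by apply: cvgN; exact: g2.
by apply/funext => y /=; case: (g y).
Qed.

Lemma ccontinuous_cis (g : T -> R) : continuous g -> ccontinuous (fun x => cis (g x)).
Proof.
move=> gc; split=> x.
  by apply: (@continuous_comp _ _ _ g cos); [exact: gc|exact: continuous_cos].
by apply: (@continuous_comp _ _ _ g sin); [exact: gc|exact: continuous_sin].
Qed.

Lemma ccontinuous_sum (I : Type) (r : seq I) (F : I -> T -> R[i]) :
  (forall i, ccontinuous (F i)) -> ccontinuous (fun x => \sum_(i <- r) F i x).
Proof.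
move=> Fc; elim: r => [|i r IH].
  by under eq_fun do rewrite big_nil; exact: ccontinuous_cst.
by under eq_fun do rewrite big_cons; exact: ccontinuousD.
Qed.

Lemma ccontinuous_prod (I : Type) (r : seq I) (F : I -> T -> R[i]) :
  (forall i, ccontinuous (F i)) -> ccontinuous (fun x => \prod_(i <- r) F i x).
Proof.
move=> Fc; elim: r => [|i r IH].
  by under eq_fun do rewrite big_nil; exact: ccontinuous_cst.
by under eq_fun do rewrite big_cons; exact: ccontinuousM.
Qed.

Lemma ccontinuous_qubit (g h : T -> R) b : continuous g -> continuous h ->
  ccontinuous (fun x => qubit (g x) (h x) 0 b).
Proof.
move=> gc hc; have h1c : continuous (fun x => 1 - h x).
  by move=> x; apply: cvgB; [exact: cvg_cst|exact: hc].
rewrite /qubit; under eq_fun do rewrite mxE.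
case: (b == 0).
  apply: ccontinuousD; first exact: ccontinuous_real.
  apply: ccontinuousM; first exact: ccontinuous_real.
  apply: ccontinuous_cis => x; apply: cvgN; apply: cvgM; first exact: cvg_cst.
  exact: gc.
by apply: ccontinuous_real => x; apply: cvgM; [exact: hc|exact: h1c].
Qed.

Lemma continuous_sum_cabs_sqr (I : Type) (r : seq I) (F : I -> T -> R[i]) :
  (forall i, ccontinuous (F i)) ->
  continuous (fun x => \sum_(i <- r) cabs (F i x) ^+ 2 : R).
Proof.
move=> Fc; elim: r => [|i r IH].
  by under eq_fun do rewrite big_nil; move=> x; exact: cvg_cst.
under eq_fun do rewrite big_cons cabs_sqr !expr2.
have [h1 h2] := Fc i; move=> x; apply: cvgD; last exact: IH.
by apply: cvgD; apply: cvgM; by [exact: h1|exact: h2].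
Qed.

End ComplexContinuity.

Lemma ccontinuous_torus_qubits j b :
  ccontinuous (fun p : 'rV[R]_(n + n) => torus_qubits p j 0 b).
Proof. by apply: ccontinuous_qubit; exact: coord_continuous. Qed.

Lemma ccontinuous_torus_section i : ccontinuous (torus_section S c i).
Proof.
rewrite /torus_section; under eq_fun do rewrite prod_formE.
apply: ccontinuous_sum => k; apply: ccontinuousM; last exact: ccontinuous_cst.
apply: ccontinuous_prod => j; apply: ccontinuous_conj_if.
exact: ccontinuous_torus_qubits.
Qed.

(** A positive minimum of [F] on the compact unit cube would be undercut at a point where all
    sections are smaller than [delta]. *)
Lemma torus_common_zero : exists p : 'rV[R]_(n + n), forall i, torus_section S c i p = 0.
Proof.
pose F (p : 'rV[R]_(n + n)) := \sum_i cabs (torus_section S c i p) ^+ 2.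
pose K : set 'rV[R]_(n + n) := [set p | forall a, `[0, 1]%classic (p ord0 a)]%classic.
have Fc : continuous F.
  have := @continuous_sum_cabs_sqr 'rV[R]_(n + n) _ (index_enum 'I_n) _
    ccontinuous_torus_section.
  exact.
have Kc : compact K.
  exact: (@rV_compact R (n + n) (fun=> `[0, 1]%classic) (fun=> @segment_compact R 0 1)).
have K0 : (K !=set0)%classic.
  by exists 0 => a /=; rewrite mxE in_itv /= lexx ler01.
have [p pK pmin] := EVT_min_rV K0 Kc (continuous_subspaceT Fc).
exists p => i; apply/eqP; rewrite -cabs_eq0; apply: contraT => fi0.
have Fp : 0 < F p.
  rewrite /F (bigD1 i) //= ltr_pwDl ?exprn_even_gt0 ?fi0 //.
  by apply: sumr_ge0 => j _; rewrite sqr_ge0.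
(* With [n.+1] in place of [n], [n] copies of [delta ^+ 2] add up to strictly less than [F p], also
   for [n = 0]. *)
pose delta := Num.sqrt (F p / n.+1%:R).
have d0 : 0 < delta by rewrite sqrtr_gt0 divr_gt0.
have [q [qK qs]] := torus_section_small d0.
have : F q < F p.
  apply: (@le_lt_trans _ _ (\sum_(j < n) delta ^+ 2)).
    by apply: ler_sum => j _; rewrite lerXn2r ?nnegrE ?cabs_ge0 ?(ltW d0) ?(ltW (qs j)).
  rewrite sumr_const card_ord sqr_sqrtr ?ltW ?divr_gt0 // -[_ *+ n]mulr_natr.
  by rewrite -mulrA gtr_pMr // mulrC ltr_pdivrMr // mul1r ltr_nat.
rewrite ltNge pmin // inE => a /=.
by rewrite in_itv /= qK.
Qed.

End CommonZero.

(** * Nonzero product vectors and equations of hyperplanes *)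

Lemma prodvec_neq0 (R : realType) (n : nat) (psi : 'I_n -> 'rV[R[i]]_2) :
  (forall j, psi j != 0) -> prodvec psi != 0.
Proof.
move=> psi0.
have ex j : exists b, psi j 0 b != 0.
  apply: contrapT => H; have /eqP := psi0 j; apply; apply/rowP => b.
  by rewrite mxE; apply/eqP; apply: contraT => hb; case: H; exists b.
pose b : bits n := [ffun j => projT1 (cid (ex j))].
apply/eqP => /rowP/(_ (enum_rank b)); rewrite !mxE => /eqP/prodf_eq0[j _].
by rewrite enum_rankK ffunE; apply/negP; exact: projT2 (cid (ex j)).
Qed.

Lemma rank_orthC (R : realType) (m : nat) (D : 'M[R[i]]_m) :
  \rank (orthC D) = (m - \rank D)%N.
Proof. by rewrite /orthC mxrank_ker mxrank_tr mxrank_map. Qed.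

(** The cokernel matrix of [D] has rank 1, so its column base is a single column, which serves as
    the equation [c]. *)
Lemma hyperplane_eq (K : fieldType) (m : nat) (D : 'M[K]_m) :
  (m - \rank D)%N = 1%N ->
  exists c : 'cV[K]_m, forall v : 'rV[K]_m, v *m c = 0 -> (v <= D)%MS.
Proof.
move=> D1; have r1 : \rank (cokermx D) = 1%N by rewrite mxrank_coker.
have [c cP] : exists c : 'cV[K]_m,
    forall v : 'rV[K]_m, v *m c = 0 -> v *m col_base (cokermx D) = 0.
  (* The rank occurs in the type of [col_base]; generalising the matrix first allows rewriting it to
     1. *)
  by move: (col_base _); rewrite r1 => B; exists B.
by exists c => v /cP vB; rewrite submxE -(mulmx_base (cokermx D)) mulmxA vB mul0mx.
Qed.

(* Subspaces D_i of (C^2)^{tensor n} are represented as row spaces of square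
   matrices D i : 'M_(2^n); membership is (v <= D i)%MS. *)
Theorem theorem3p1 (R : realType) (n : nat)
    (S : 'I_n -> {set 'I_n})
    (D : 'I_n -> 'M[R[i]]_(tdim n))
    (hD : forall i, \rank (orthC (D i)) = 1%N)
    (hper : per (sigma_mx S) != 0) :
  exists psi : 'I_n -> 'rV[R[i]]_2,
    prodvec psi != 0 /\
    forall i, (prodvec (pconj (S i) psi) <= D i)%MS.
Proof.
have cex i : exists c : 'cV[R[i]]_(tdim n),
    forall v : 'rV_(tdim n), v *m c = 0 -> (v <= D i)%MS.
  by apply: hyperplane_eq; rewrite -rank_orthC hD.
pose c i := projT1 (cid (cex i)).
have [p p0] := torus_common_zero c hper.
exists (torus_qubits p); split.
  by apply: prodvec_neq0 => j; exact: qubit_neq0.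
move=> i; apply: (projT2 (cid (cex i))).
by apply/matrixP => x y; rewrite !ord1 [RHS]mxE; exact: p0.
Qed.
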